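(* Let $X$ be a Banach space over $\mathbb{K}=\mathbb{R}$ or $\mathbb{C}$ that fails the bounded compact approximation property. Suppose that there is a positive integer $m$ such that every noninvertible element $a$ of the Calkin algebra $\operatorname{Cal}(X)=\mathcal{L}(X)/\mathcal{K}(X)$ satisfies $a^m=0$. Then $X$ has the Lotz property.
   Context: $\mathcal{L}(X)$ denotes the algebra of bounded linear operators on $X$, $\mathcal{K}(X)$ the ideal of compact operators, and $\operatorname{Cal}(X)=\mathcal{L}(X)/\mathcal{K}(X)$ the quotient unital Banach algebra. An element of a unital algebra is noninvertible if it has no two-sided inverse. $X$ has the bounded compact approximation property (BCAP) if there is a constant $C\ge 1$ such that for every compact set $D\subset X$ and every $\varepsilon>0$ there is $K\in\mathcal{K}(X)$ with $\|K\|\le C$ and $\sup_{x\in D}\|Kx-x\|<\varepsilon$. A $C_0$-semigroup on $X$ is a family $(T(t))_{t\ge 0}\subset\mathcal{L}(X)$ with $T(0)=I_X$, $T(t+s)=T(t)T(s)$ for $t,s\ge 0$, and $\lim_{t\downarrow 0}\|T(t)x-x\|=0$ for every $x\in X$. It is uniformly continuous if $\lim_{t\downarrow 0}\|T(t)-I_X\|=0$. $X$ has the Lotz property if every $C_0$-semigroup on $X$ is uniformly continuous. *)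

(* Defs.v *)
From HB Require Import structures.
From mathcomp Require Import all_boot all_order all_algebra.
From mathcomp Require Import ring_quotient.
From mathcomp Require Import all_classical all_reals all_analysis.
From mathcomp Require Import complex.

Set Implicit Arguments.
Unset Strict Implicit.
Unset Printing Implicit Defensive.

Import Order.TTheory GRing.Theory Num.Theory.
Import numFieldNormedType.Exports.

Local Open Scope classical_set_scope.
Local Open Scope ring_scope.
Local Open Scope quotient_scope.

Variant scalar_kind := RealScalars | ComplexScalars.

Definition scalar_field (R : realType) (k : scalar_kind) : numFieldType :=
  match k with
  | RealScalars => R
  | ComplexScalars => R[i]
  end.

Section BoundedOperators.
Context {K : numFieldType} {X : normedModType K}.

Definition bounded_op : {pred X -> X} :=
  [pred f : X -> X |
    `[< linear f /\ exists M : K, forall x, `|f x| <= M * `|x| >]].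

Lemma bounded_opP (f : X -> X) :
  reflect (linear f /\ exists M : K, forall x, `|f x| <= M * `|x|)
          (f \in bounded_op).
Proof. exact: asboolP. Qed.

Lemma bounded_op_zmod_closed : zmod_closed bounded_op.
Proof.
split=> [|f g /bounded_opP[lf [M fM]] /bounded_opP[lg [N gN]]]; apply/bounded_opP.
  split=> [a u v|]; first by rewrite /= scaler0 addr0.
  by exists 0 => x; rewrite /= normr0 mul0r.
split=> [a u v|].
  by rewrite /GRing.add/= /GRing.opp/= lf lg scalerBr opprD addrACA.
exists (M + N) => x; rewrite mulrDl (le_trans (ler_normB _ _))//.
by rewrite lerD.
Qed.

HB.instance Definition _ :=
  GRing.isZmodClosed.Build (X -> X) bounded_op bounded_op_zmod_closed.

End BoundedOperators.

Record bop (K : numFieldType) (X : normedModType K) := Bop {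
  bop_fun :> X -> X ;
  bop_prop : bop_fun \in bounded_op }.

Notation "''L' ( X )" := (bop X) (at level 8, format "''L' ( X )") : type_scope.

HB.instance Definition _ (K : numFieldType) (X : normedModType K) :=
  [isSub of bop X for @bop_fun K X].
HB.instance Definition _ (K : numFieldType) (X : normedModType K) :=
  [Choice of bop X by <:].
HB.instance Definition _ (K : numFieldType) (X : normedModType K) :=
  [SubChoice_isSubZmodule of bop X by <:].

Section OperatorRing.
Context {K : numFieldType} {X : normedModType K}.
Implicit Types S T U : 'L(X).

Lemma bop_linear T : linear T.
Proof. by have /bounded_opP[] := bop_prop T. Qed.

HB.instance Definition _ T :=
  GRing.isLinear.Build K X X *:%R (bop_fun T) (bop_linear T).

Lemma bop_bound T : exists2 M : K, 0 < M & forall x, `|T x| <= M * `|x|.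
Proof.
have /bounded_opP[_ [M TM]] := bop_prop T.
exists (`|M| + 1) => [|x]; first by rewrite ltr_wpDl.
have MxE : M * `|x| = `|M| * `|x|.
  rewrite -[in RHS](normr_id x) -normrM ger0_norm//.
  exact: le_trans (normr_ge0 _) (TM x).
by rewrite (le_trans (TM x))// MxE ler_wpM2r// lerDl.
Qed.

Lemma bop_continuous T : continuous T.
Proof.
apply/bounded_linear_continuous/bounded_funP => r.
have [M M0 TM] := bop_bound T; exists (M * r) => x xr.
by rewrite (le_trans (TM x))// ler_wpM2l// ltW.
Qed.

Lemma bop1_subproof : id \in @bounded_op K X.
Proof. by apply/bounded_opP; split=> //; exists 1 => x; rewrite mul1r. Qed.

Definition bop1 : 'L(X) := Bop bop1_subproof.

Lemma bopM_subproof S T : S \o T \in bounded_op.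
Proof.
apply/bounded_opP; split=> [a u v|]; first by rewrite /= !linearP.
have [M M0 SM] := bop_bound S; have [N N0 TN] := bop_bound T.
exists (M * N) => x; rewrite (le_trans (SM _))// -mulrA.
by rewrite ler_wpM2l// ltW.
Qed.

Definition bopM S T : 'L(X) := Bop (bopM_subproof S T).

Lemma bopP S T : (forall x, S x = T x) -> S = T.
Proof. by move=> ST; apply: val_inj; apply/funext. Qed.

Lemma bopMA : associative bopM. Proof. by move=> S T U; exact: bopP. Qed.
Lemma bop1M : left_id bop1 bopM. Proof. by move=> T; exact: bopP. Qed.
Lemma bopM1 : right_id bop1 bopM. Proof. by move=> T; exact: bopP. Qed.
Lemma bopMDl : left_distributive bopM +%R.
Proof. by move=> S T U; exact: bopP. Qed.
Lemma bopMDr : right_distributive bopM +%R.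
Proof. by move=> S T U; apply: bopP => x; rewrite /= linearD. Qed.

End OperatorRing.

HB.instance Definition _ (K : numFieldType) (X : normedModType K) :=
  GRing.Zmodule_isPzRing.Build (bop X)
    (@bopMA K X) (@bop1M K X) (@bopM1 K X) (@bopMDl K X) (@bopMDr K X).

Section CompactOperators.
Context {K : numFieldType} {X : normedModType K}.
Implicit Types S T : 'L(X).

Definition compact_op : {pred 'L(X)} :=
  [pred T : 'L(X) | `[< compact (closure (T @` [set x | `|x| <= 1])) >]].

Lemma compact_opP T :
  reflect (compact (closure (T @` [set x | `|x| <= 1]))) (T \in compact_op).
Proof. exact: asboolP. Qed.

Lemma compact_op_sub T (A : set X) :
  compact A -> T @` [set x | `|x| <= 1] `<=` A -> T \in compact_op.
Proof.
move=> cA TA; apply/compact_opP; apply: (subclosed_compact _ cA).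
  exact: closed_closure.
by rewrite (closure_id A).1; [exact: closure_subset|
   apply: compact_closed => //; exact: norm_hausdorff].
Qed.

Lemma compact_op_zmod_closed : zmod_closed compact_op.
Proof.
split=> [|S T /compact_opP cS /compact_opP cT].
  apply: (@compact_op_sub _ [set 0]); first exact: compact_set1.
  by move=> _ [x _ <-].
have cST := compact_setX cS cT.
apply: (compact_op_sub (continuous_compact (f := fun z => z.1 - z.2) _ cST)).
  apply: continuous_subspaceT => z.
  by apply: cvgB; [exact: cvg_fst|exact: cvg_snd].
move=> _ [x x1 <-]; exists (S x, T x) => //.
by split; apply: subset_closure; exists x.
Qed.

HB.instance Definition _ :=
  GRing.isZmodClosed.Build 'L(X) compact_op compact_op_zmod_closed.

Lemma compact_opMl S T : T \in compact_op -> S * T \in compact_op.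
Proof.
move=> /compact_opP cT.
apply: (compact_op_sub (continuous_compact (f := S) _ cT)).
  exact/continuous_subspaceT/bop_continuous.
by move=> _ [x x1 <-]; exists (T x) => //; apply: subset_closure; exists x.
Qed.

Lemma compact_opMr S T : S \in compact_op -> S * T \in compact_op.
Proof.
move=> /compact_opP cS; have [M M0 TM] := bop_bound T.
apply: (compact_op_sub (continuous_compact (f := fun y => M *: y) _ cS)).
  exact/continuous_subspaceT/scaler_continuous.
move=> _ [x x1 <-]; exists (S (M^-1 *: T x)); last first.
  by rewrite linearZ /= scalerA mulfV ?gt_eqF// scale1r.
apply: subset_closure; exists (M^-1 *: T x) => //=.
rewrite normrZ gtr0_norm ?invr_gt0// ler_pdivrMl// mulr1.
by rewrite (le_trans (TM x))// ler_piMr// ltW.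
Qed.

End CompactOperators.

Definition calkin (K : numFieldType) (X : normedModType K) : Type :=
  {ideal_quot (@compact_op K X)}.

Notation "''Cal' ( X )" := (calkin X)
  (at level 8, format "''Cal' ( X )") : type_scope.

HB.instance Definition _ (K : numFieldType) (X : normedModType K) :=
  GRing.Zmodule.on (calkin X).

Section CalkinRing.
Context {K : numFieldType} {X : normedModType K}.
Local Notation Q := {ideal_quot (@compact_op K X)}.

Definition calkin1 : Q := lift_cst Q 1.
Definition calkinM := lift_op2 Q *%R.

Canonical pi_calkin1_morph := PiConst calkin1.

Lemma pi_calkinM : {morph \pi_Q : x y / x * y >-> calkinM x y}.
Proof.
move=> x y; unlock calkinM; apply/eqP; rewrite piE Quotient.equivE.
set x' := repr _; set y' := repr _.
rewrite -[x * y](addrNK (x * y')) -mulrBr -addrA -mulrBl rpredD//.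
  by apply: compact_opMl; rewrite Quotient.idealrBE reprK.
by apply: compact_opMr; rewrite Quotient.idealrBE reprK.
Qed.
Canonical pi_calkinM_morph := PiMorph2 pi_calkinM.

Lemma calkinMA : associative calkinM.
Proof. by move=> x y z; rewrite -[x]reprK -[y]reprK -[z]reprK !piE mulrA. Qed.

Lemma calkin1M : left_id calkin1 calkinM.
Proof. by move=> x; rewrite -[x]reprK !piE mul1r. Qed.

Lemma calkinM1 : right_id calkin1 calkinM.
Proof. by move=> x; rewrite -[x]reprK !piE mulr1. Qed.

Lemma calkinMDl : left_distributive calkinM +%R.
Proof.
by move=> x y z; rewrite -[x]reprK -[y]reprK -[z]reprK !piE mulrDl.
Qed.

Lemma calkinMDr : right_distributive calkinM +%R.
Proof.
by move=> x y z; rewrite -[x]reprK -[y]reprK -[z]reprK !piE mulrDr.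
Qed.

End CalkinRing.

HB.instance Definition _ (K : numFieldType) (X : normedModType K) :=
  GRing.Zmodule_isPzRing.Build (calkin X)
    (@calkinMA K X) (@calkin1M K X) (@calkinM1 K X)
    (@calkinMDl K X) (@calkinMDr K X).

Definition noninvertible (A : pzRingType) (a : A) : Prop :=
  ~ exists b : A, a * b = 1 /\ b * a = 1.

(* Norms take their values in K, and suprema are taken in the order of K. When K
   is the complex field this is the partial order x <= y <-> y - x is a
   nonnegative real; the upper bounds of a nonempty set of reals are then real,
   so this is still the real supremum. *)
Lemma scalar_supremumP (R : realType) (k : scalar_kind)
    (A : set (scalar_field R k)) :
  A !=set0 -> A `<=` [set x | 0 <= x] -> ubound A !=set0 ->
  supremums A (supremum 0 A).
Proof.
move=> A0 Age uA.
suff [c Ac] : supremums A !=set0.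
  rewrite /supremum; case: eqP => [AE|_]; first by case: A0 => x; rewrite AE.
  by case: xgetP => // /(_ c).
case: k A A0 Age uA => /= A A0 Age uA.
  exists (sup A); split; first exact: sup_ubound.
  by move=> u uu; apply: ge_sup.
have AB z : A z -> z = ((complex.Re z)%:C)%C.
  by move=> /Age /=; case: z => a b; rewrite lecE => /andP[/eqP /= -> _].
pose B : set R := [set complex.Re z | z in A].
have B0 : B !=set0 by case: A0 => z Az; exists (complex.Re z); exists z.
have [u uu] := uA.
have Bu : has_ubound B.
  exists (complex.Re u) => _ [z /uu + <-].
  by rewrite lecE => /andP[].
exists ((sup B)%:C)%C; split=> [z Az|v vA].
  by rewrite (AB z Az) lecR; apply: ub_le_sup => //; exists z.
have [z Az] := A0; have := vA z Az; rewrite (AB z Az) lecE/= => /andP[Imv _].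
rewrite lecE/= Imv/=; apply: ge_sup => // _ [w Aw <-].
by have := vA w Aw; rewrite lecE => /andP[].
Qed.

Section Properties.
Context {K : numFieldType}.

Definition opnorm (X : normedModType K) (T : 'L(X)) : K :=
  supremum 0 [set `|T x| | x in [set x : X | `|x| <= 1]].

Definition BCAP (X : normedModType K) : Prop :=
  exists2 C : K, 1 <= C &
    forall D : set X, compact D -> forall e : K, 0 < e ->
      exists T : 'L(X), [/\ T \in compact_op, opnorm T <= C &
        supremum 0 [set `|T x - x| | x in D] < e].

(* Semigroups are families over all of R of which only the restriction to the
   nonnegative times is constrained. *)
Definition C0_semigroup (R : realType) (X : normedModType K) (T : R -> 'L(X)) :
    Prop :=
  [/\ T 0 = 1,
      forall t s : R, 0 <= t -> 0 <= s -> T (t + s) = T t * T s &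
      forall x : X, `|T t x - x| @[t --> (0 : R)^'+] --> (0 : K)].

Definition uniformly_continuous_semigroup (R : realType) (X : normedModType K)
    (T : R -> 'L(X)) : Prop :=
  opnorm (T t - 1) @[t --> (0 : R)^'+] --> (0 : K).

Definition Lotz (R : realType) (X : normedModType K) : Prop :=
  forall T : R -> 'L(X), C0_semigroup T -> uniformly_continuous_semigroup T.

End Properties.

(* Main.v *)
Require Import Defs.
From mathcomp Require Import all_boot all_order all_algebra.
From mathcomp Require Import ring_quotient.
From mathcomp Require Import all_classical all_reals all_analysis.
From mathcomp Require Import complex.
From mathcomp Require Import ring.

Set Implicit Arguments.
Unset Strict Implicit.
Unset Printing Implicit Defensive.

Import Order.TTheory GRing.Theory Num.Theory.
Import numFieldNormedType.Exports.

Local Open Scope classical_set_scope.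
Local Open Scope ring_scope.

(** Write pi for the quotient map onto the Calkin algebra, and let
    S_j x = (1/h_j) int_0^h_j T(s) x ds, with h_j = 2^-j, be the means of a
    C_0-semigroup T over shrinking dyadic intervals. By uniform boundedness
    (semigroup_bounded) the S_j are uniformly bounded and converge strongly to
    the identity; and S_j maps into the domain of the generator: with
    tau_n = T(2^-n), one has |(tau_n - 1) S_j| <= c_j 2^-n for all n
    (mean_operators).

    If no pi(S_j) had a right inverse, all the S_j^m would be compact. They too
    are uniformly bounded and converge strongly, hence uniformly on compact
    sets, to the identity, so X would have the BCAP
    (BCAP_of_compact_approx_unit). Hence some S_i is right invertible modulo
    compact operators: S_i B = 1 + C with C compact. In textbook terms S_i is
    then Fredholm, so the domain of the generator contains a closed subspace of
    finite codimension; being dense it is all of X, and the generator is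
    bounded.

    The last step is carried out as a direct estimate
    (small_of_small_on_approx_unit). As C is compact, |S_j C - C| <= 1/2 for
    some j, and in
      tau_n - 1 = (tau_n - 1) S_i B - (tau_n - 1) S_j C
                  + (tau_n - 1) (S_j C - C)
    the first two terms are O(2^-n) while the third has norm at most
    |tau_n - 1| / 2, which is absorbed by the left-hand side. So
    |tau_n - 1| = O(2^-n); the semigroup law spreads this Lipschitz bound to all
    dyadic times, and strong continuity to all times
    (uniformly_continuous_of_dyadic).

    The integral S_j is built as the strong limit of Riemann sums over dyadic
    subdivisions (riemann_mean), on which everything reduces to the geometric
    sum of the powers of tau_(j+N). The real and the complex case are treated
    together; norms then take values in a field which may be only partially
    ordered, so comparisons are made between elements known to be real. *)

(** * Scalars and operator norms *)

Section ScalarField.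
Context {R : realType} {k : scalar_kind}.
Local Notation K := (scalar_field R k).

(** The Archimedean property. In the complex case a positive scalar is a real
    one, so the real case applies. *)
Lemma exists_half_pow_lt (e : K) : 0 < e -> exists n, 2^-1 ^+ n < e.
Proof.
have real_case (r : R) : 0 < r -> exists n, 2^-1 ^+ n < r.
  move=> r0; exists (Num.trunc r^-1).+1.
  rewrite exprVn invf_plt ?posrE ?exprn_gt0//.
  have rV0 : 0 <= r^-1 by rewrite invr_ge0 ltW.
  have /andP[_ /lt_trans] := truncn_itv rV0; apply.
  by rewrite -natrX ltr_nat ltn_expl.
case: k e => //= e; rewrite ltcE /= => /andP[/eqP Ime Ree].
have [n nRe] := real_case _ Ree; exists n.
have -> : e = ((complex.Re e)%:C)%C by case: e Ime {Ree nRe} => a b /= ->.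
have -> : 2^-1 = ((2^-1 : R)%:C)%C :> R[i] by rewrite fmorphV rmorph_nat.
by rewrite -rmorphXn ltcR.
Qed.
End ScalarField.

Section OperatorNorm.
Context {R : realType} {k : scalar_kind}.
Local Notation K := (scalar_field R k).
Context {X : normedModType K}.
Implicit Types (S T : 'L(X)) (x : X) (c : K).

Let opnorm_sup T :
  supremums [set `|T x| | x in [set x : X | `|x| <= 1]] (opnorm T).
Proof.
apply: scalar_supremumP.
- by exists `|T 0|; exists 0 => //=; rewrite normr0.
- by move=> _ [x _ <-] /=.
- have [M M0 TM] := bop_bound T; exists M => _ [x /= x1 <-].
  by rewrite (le_trans (TM x))// ler_piMr// ltW.
Qed.

Lemma opnorm_ge0 T : 0 <= opnorm T.
Proof.
have [ub _] := opnorm_sup T.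
by apply: le_trans (normr_ge0 (T 0)) (ub _ _); exists 0; rewrite //= normr0.
Qed.

Lemma opnormP T x : `|T x| <= opnorm T * `|x|.
Proof.
have [->|x0] := eqVneq x 0; first by rewrite linear0 !normr0 mulr0.
have nx0 : 0 < `|x| by rewrite normr_gt0.
have [ub _] := opnorm_sup T.
rewrite -ler_pdivrMr// mulrC.
have -> : `|x|^-1 * `|T x| = `|T (`|x|^-1 *: x)|.
  by rewrite linearZ /= normrZ gtr0_norm ?invr_gt0.
apply: ub; exists (`|x|^-1 *: x) => //=.
by rewrite normrZ gtr0_norm ?invr_gt0// mulVf ?gt_eqF.
Qed.

Lemma opnorm_le_ball T c : (forall x, `|x| <= 1 -> `|T x| <= c) -> opnorm T <= c.
Proof. by move=> Tc; apply: (opnorm_sup T).2 => _ [x x1 <-]; exact: Tc. Qed.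

Lemma opnorm_le T c : 0 <= c -> (forall x, `|T x| <= c * `|x|) -> opnorm T <= c.
Proof.
move=> c0 Tc; apply: opnorm_le_ball => x x1.
by rewrite (le_trans (Tc x))// ler_piMr.
Qed.

Lemma opnorm_leP T c x : opnorm T <= c -> `|T x| <= c * `|x|.
Proof. by move=> Tc; rewrite (le_trans (opnormP T x))// ler_wpM2r. Qed.

Lemma opnormM S T : opnorm (S * T) <= opnorm S * opnorm T.
Proof.
apply: opnorm_le => [|x]; first by rewrite mulr_ge0// opnorm_ge0.
rewrite (le_trans (opnormP S _))// -mulrA.
by rewrite ler_wpM2l ?opnorm_ge0// opnormP.
Qed.

Lemma opnormD S T : opnorm (S + T) <= opnorm S + opnorm T.
Proof.
apply: opnorm_le => [|x]; first by rewrite addr_ge0// opnorm_ge0.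
by rewrite (le_trans (ler_normD _ _))// mulrDl lerD// opnormP.
Qed.

Lemma opnormN T : opnorm (- T) = opnorm T.
Proof. by rewrite /opnorm; under eq_imagel do rewrite /= normrN. Qed.

Lemma opnorm1_le : opnorm (1 : 'L(X)) <= 1.
Proof. by apply: opnorm_le => // x; rewrite mul1r. Qed.

Lemma opnormX T n : opnorm (T ^+ n) <= opnorm T ^+ n.
Proof.
elim: n => [|n IHn]; first exact: opnorm1_le.
by rewrite !exprS (le_trans (opnormM _ _))// ler_wpM2l ?opnorm_ge0.
Qed.

End OperatorNorm.

(** * Sequences of vectors *)

Section Sequences.
Context {R : realType} {k : scalar_kind}.
Local Notation K := (scalar_field R k).
Local Notation h := (2^-1 : K).

Lemma half_double (e : K) : h * e + h * e = e.
Proof. by rewrite mulrC -splitr. Qed.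

(** Explicit epsilon-N convergence, to keep the estimates free of filters. *)
Definition seq_tends (V : normedModType K) (u : nat -> V) (l : V) : Prop :=
  forall e : K, 0 < e -> exists N, forall n, (N <= n)%N -> `|u n - l| <= e.

Lemma cauchy_seq_tends (X : completeNormedModType K) (u : nat -> X) :
  (forall e : K, 0 < e -> exists N, forall p, `|u (N + p)%N - u N| <= e) ->
  exists l, seq_tends u l.
Proof.
move=> uC.
have /cauchy_cvgP/cvg_ex[l ul] : cauchy (u n @[n --> \oo]).
  apply: cauchy_exP => e e0; have [|N NP] := uC (h * e).
    by rewrite mulr_gt0 ?invr_gt0.
  exists (u N); exists N => //= n Nn.
  rewrite -ball_normE /= distrC -(subnKC Nn) (le_lt_trans (NP _))//.
  by rewrite gtr_pMl// invf_lt1 // ltr1n.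
exists l => e e0; have /cvgrPdist_le/(_ e e0)[N _ NP] := ul.
by exists N => n Nn; rewrite distrC; apply: NP.
Qed.

Lemma seq_tends_unique (V : normedModType K) (u : nat -> V) l l' :
  seq_tends u l -> seq_tends u l' -> l = l'.
Proof.
move=> ul ul'; apply/eqP; rewrite -subr_eq0 -normr_eq0 eq_le normr_ge0 andbT.
apply/ler_addgt0Pr => e e0; rewrite add0r.
have he0 : 0 < h * e by rewrite mulr_gt0 ?invr_gt0.
have [N NP] := ul _ he0; have [N' NP'] := ul' _ he0.
have := NP' _ (leq_maxr N N'); have := NP _ (leq_maxl N N').
set n := maxn _ _ => P P'.
have -> : l - l' = (u n - l') - (u n - l) by rewrite opprB [RHS]addrC addrA subrK.
rewrite (le_trans (ler_normB _ _))// (le_trans (lerD P' P))//.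
by rewrite half_double.
Qed.

Lemma seq_tends_norm_le (V : normedModType K) (u : nat -> V) l (c : K) N :
  seq_tends u l -> (forall n, (N <= n)%N -> `|u n| <= c) -> `|l| <= c.
Proof.
move=> ul uc; apply/ler_addgt0Pr => e e0; have [N' NP] := ul _ e0.
have := NP _ (leq_maxr N N'); have := uc _ (leq_maxl N N').
set n := maxn _ _ => P P'.
have -> : l = u n - (u n - l) by rewrite opprB [RHS]addrC subrK.
by rewrite (le_trans (ler_normB _ _))// lerD.
Qed.

Lemma seq_tendsD (V : normedModType K) (u v : nat -> V) l l' :
  seq_tends u l -> seq_tends v l' -> seq_tends (fun n => u n + v n) (l + l').
Proof.
move=> ul vl e e0.
have he0 : 0 < h * e by rewrite mulr_gt0 ?invr_gt0.
have [N NP] := ul _ he0; have [N' NP'] := vl _ he0.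
exists (maxn N N') => n; rewrite geq_max => /andP[Nn N'n].
rewrite opprD addrACA (le_trans (ler_normD _ _))//.
rewrite (le_trans (lerD (NP _ Nn) (NP' _ N'n)))//.
by rewrite half_double.
Qed.

Lemma seq_tends_bop (V : normedModType K) (T : 'L(V)) (u : nat -> V) l :
  seq_tends u l -> seq_tends (fun n => T (u n)) (T l).
Proof.
move=> ul e e0; have [M M0 TM] := bop_bound T.
have [|N NP] := ul (M^-1 * e); first by rewrite mulr_gt0 ?invr_gt0.
exists N => n Nn; rewrite -linearB (le_trans (TM _))//.
by rewrite -ler_pdivlMl// NP.
Qed.

Lemma seq_tends_shift (V : normedModType K) (u : nat -> V) l m :
  seq_tends u l -> seq_tends (fun n => u (m + n)%N) l.
Proof.
move=> ul e e0; have [N NP] := ul e e0; exists N => n Nn.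
by apply: NP; rewrite (leq_trans Nn) ?leq_addl.
Qed.

End Sequences.

(** * The uniform boundedness principle *)

Section UniformBoundedness.
Context {R : realType} {k : scalar_kind}.
Local Notation K := (scalar_field R k).
Local Notation h := (2^-1 : K).
Context {X : completeNormedModType K}.

(** The norm of T is approached on each sphere; the factor 1/2 leaves room since
    it need not be attained. *)
Lemma exists_almost_norming (T : 'L(X)) (r : K) : 0 < opnorm T -> 0 < r ->
  exists2 v : X, `|v| = r & h * opnorm T * r <= `|T v|.
Proof.
move=> T0 r0; apply: contrapT => nv.
suff : opnorm T <= h * opnorm T.
  by rewrite lt_geF // gtr_pMl// invf_lt1 // ltr1n.
apply: opnorm_le => [|x]; first by rewrite mulr_ge0 ?invr_ge0 ?ltW.
have [->|x0] := eqVneq x 0; first by rewrite linear0 !normr0 mulr0.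
have nx0 : 0 < `|x| by rewrite normr_gt0.
have rx0 : 0 < r / `|x| by rewrite divr_gt0.
have vr : `|(r / `|x|) *: x| = r by rewrite normrZ gtr0_norm// divfK ?gt_eqF.
have /negP : ~ h * opnorm T * r <= `|T ((r / `|x|) *: x)|.
  by move=> ?; apply: nv; exists ((r / `|x|) *: x).
have real0 : h * opnorm T * r \is Num.real.
  by rewrite ger0_real// !mulr_ge0 ?invr_ge0 ?ltW.
rewrite -real_ltNge// ?normr_real// => /ltW.
rewrite linearZ /= normrZ gtr0_norm// mulrC mulrA ler_pdivrMr//.
by rewrite [leRHS]mulrAC ler_pM2r.
Qed.

(** 2b is the difference of a + b and a - b. *)
Lemma norm_add_or_sub_ge (a b : X) : `|b| <= `|a + b| \/ `|b| <= `|a - b|.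
Proof.
have [?|lt1] := boolP (`|b| <= `|a + b|); [by left|right].
apply: contraT => lt2.
have b2 : `|b| + `|b| <= `|a + b| + `|a - b|.
  rewrite -mulr2n -normrMn mulr2n.
  have -> : b + b = (a + b) - (a - b) by rewrite opprB [RHS]addrC addrA subrK.
  exact: ler_normB.
move: lt1 lt2; rewrite -!real_ltNge ?normr_real// => lt1 lt2.
by have := ltrD lt1 lt2; rewrite le_gtF.
Qed.

(** A gliding hump argument, valid over both scalar fields. Otherwise pick W_n in
    the family with |W_n| > 4 * 16^n, and vectors v_n of norm 8^-n on which W_n
    nearly attains its norm. Choosing signs one after the other, the partial sums
    x_n of the series of the +v_n or -v_n satisfy
    |W_n x_(n+1)| >= |W_n| 8^-n / 2. The rest of the series has norm at most
    8^-n / 4, so its sum l satisfies |W_n l| >= |W_n| 8^-n / 4 > 2^n, and the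
    family is unbounded at l. *)
Theorem uniform_boundedness (V : nat -> 'L(X)) :
  (forall x, exists c, forall n, `|V n x| <= c) ->
  exists M, forall n, opnorm (V n) <= M.
Proof.
move=> Vb; apply: contrapT => nM.
pose r n : K := 8^-1 ^+ n.
have r0 n : 0 < r n by rewrite exprn_gt0// invr_gt0.
have /choice[f fP] : forall n, exists i, 4 * 2 ^+ n / r n < opnorm (V i).
  move=> n; apply: contrapT => ni; apply: nM; exists (4 * 2 ^+ n / r n) => i.
  have real1 : 4 * 2 ^+ n / r n \is Num.real.
    by rewrite ger0_real// divr_ge0 ?(ltW (r0 _))// mulr_ge0 ?exprn_ge0.
  rewrite real_leNgt//; last exact/ger0_real/opnorm_ge0.
  by apply/negP => ?; apply: ni; exists i.
pose W n := V (f n).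
have W0 n : 0 < opnorm (W n).
  by apply: lt_trans (fP n); rewrite divr_gt0// mulr_gt0 ?exprn_gt0.
have /choice[v vP] : forall n, exists u,
    `|u| = r n /\ h * opnorm (W n) * r n <= `|W n u|.
  by move=> n; have [u] := exists_almost_norming (W0 n) (r0 n); exists u.
pose step n (a : X) :=
  if `|W n (v n)| <= `|W n (a + v n)| then a + v n else a - v n.
pose x := fix x n := if n is n'.+1 then step n' (x n') else 0 : X.
have Wx n : h * opnorm (W n) * r n <= `|W n (x n.+1)|.
  apply: (le_trans (vP n).2); rewrite /= /step.
  have [//|nle] := boolP (`|W n (v n)| <= `|W n (x n + v n)|).
  have [] := norm_add_or_sub_ge (W n (x n)) (W n (v n)).
    by rewrite -linearD (negPf nle).
  by rewrite -linearB.
have xS n : `|x n.+1 - x n| = r n.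
  rewrite /= /step; case: ifP => _; rewrite addrAC subrr add0r ?normrN.
    exact: (vP n).1.
  exact: (vP n).1.
(* Summing the geometric series would give the constant 8/7; 2 is rounder. *)
have xD n p : `|x (n + p)%N - x n| <= 2 * (r n - r (n + p)%N).
  elim: p => [|p IHp]; first by rewrite addn0 !subrr normr0 mulr0.
  rewrite addnS; set q := (n + p)%N in IHp *.
  rewrite -(subrK (x q) (x q.+1)) -addrA (le_trans (ler_normD _ _))//.
  rewrite xS (le_trans (lerD (lexx _) IHp))//.
  rewrite -subr_ge0.
  have -> : 2 * (r n - r q.+1) - (r q + 2 * (r n - r q)) = 3 / 4 * r q.
    by rewrite /r exprS; field.
  by rewrite mulr_ge0 ?divr_ge0 // ltW.
have [|l xl] := @cauchy_seq_tends _ _ X x.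
  move=> e e0; have [N Ne] : exists N, h ^+ N < h * e.
    by apply: exists_half_pow_lt; rewrite mulr_gt0 ?invr_gt0.
  exists N => p; rewrite (le_trans (xD _ _))//.
  rewrite -[leRHS]half_double -mulrDr -ler_pdivlMl// mulrDr half_double.
  rewrite (le_trans _ (ltW Ne))// (le_trans (_ : _ <= r N))//.
    by rewrite gerBl ltW.
  rewrite lerXn2r ?nnegrE ?invr_ge0//.
  by rewrite lef_pV2 ?posrE// ler_nat.
have [c cP] := Vb l.
have c0 : 0 <= c by apply: le_trans (cP 0%N).
have [n nP] : exists n, h ^+ n < (c + 1)^-1.
  by apply: exists_half_pow_lt; rewrite invr_gt0 ltr_wpDl.
have lx : `|l - x n.+1| <= 2 * r n.+1.
  apply: (@seq_tends_norm_le _ _ X (fun p => x (n.+1 + p)%N - x n.+1) _ _ 0).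
    apply: seq_tendsD; first exact: seq_tends_shift.
    by move=> e e0; exists 0%N => p _; rewrite subrr normr0 ltW.
  move=> p _; rewrite (le_trans (xD _ _))// ler_pM2l// gerBl.
  exact: ltW.
have : h * opnorm (W n) * r n <= c + opnorm (W n) * (2 * r n.+1).
  rewrite (le_trans (Wx n))//.
  have -> : W n (x n.+1) = W n l - W n (l - x n.+1).
    by rewrite -linearB opprB addrCA subrr addr0.
  rewrite (le_trans (ler_normB _ _))// lerD//; first exact: cP.
  by rewrite (le_trans (opnormP _ _))// ler_wpM2l ?opnorm_ge0.
rewrite -lerBlDr.
have -> : h * opnorm (W n) * r n - opnorm (W n) * (2 * r n.+1) =
    opnorm (W n) * r n / 4 by rewrite /r exprS; field.
have lt1 : 2 ^+ n < opnorm (W n) * r n / 4.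
  by have := fP n; rewrite ltr_pdivrMr// mulrC -ltr_pdivlMr.
have lt2 : c + 1 < 2 ^+ n.
  move: nP; rewrite exprVn ltf_pV2 ?posrE ?exprn_gt0//.
  by rewrite ltr_wpDl.
move=> /(lt_le_trans (lt_trans lt2 lt1)).
by rewrite gtrDl ltr10.
Qed.

End UniformBoundedness.

(** * Bounded approximate units *)

Section ApproximateUnits.
Context {R : realType} {k : scalar_kind}.
Local Notation K := (scalar_field R k).
Local Notation h := (2^-1 : K).
Context {X : normedModType K}.
Implicit Types (V W : nat -> 'L(X)).

Definition bounded_approx_unit V : Prop :=
  (exists2 M : K, 0 < M & forall n, opnorm (V n) <= M) /\
  forall x, seq_tends (fun n => V n x) x.

Lemma bounded_approx_unitM V W :
  bounded_approx_unit V -> bounded_approx_unit W ->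
  bounded_approx_unit (fun n => V n * W n).
Proof.
move=> [[M M0 VM] Vx] [[N N0 WN] Wx]; split.
  exists (M * N) => [|n]; first exact: mulr_gt0.
  by rewrite (le_trans (opnormM _ _))// ler_pM ?opnorm_ge0.
move=> x e e0.
have [|n1 P1] := Wx x (M^-1 * (h * e)); first by rewrite !mulr_gt0 ?invr_gt0.
have [|n2 P2] := Vx x (h * e); first by rewrite mulr_gt0 ?invr_gt0.
exists (maxn n1 n2) => n; rewrite geq_max => /andP[/P1 {}P1 /P2 {}P2].
have -> : (V n * W n) x - x = V n (W n x - x) + (V n x - x).
  by rewrite linearB addrA subrK.
rewrite (le_trans (ler_normD _ _))// -[leRHS]half_double lerD//.
by rewrite (le_trans (opnorm_leP _ (VM n)))// -ler_pdivlMl.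
Qed.

Lemma bounded_approx_unitX V m :
  bounded_approx_unit V -> bounded_approx_unit (fun n => V n ^+ m).
Proof.
move=> uV; elim: m => [|m IHm].
  split; first by exists 1 => // n; exact: opnorm1_le.
  by move=> x e e0; exists 0%N => n _; rewrite subrr normr0 ltW.
have -> : (fun n => V n ^+ m.+1) = (fun n => V n * V n ^+ m).
  by apply/funext => n; rewrite exprS.
exact: bounded_approx_unitM.
Qed.

(** Boundedness makes the V n equicontinuous, so pointwise convergence is locally
    uniform, hence uniform on compact sets. *)
Lemma approx_unit_compact V (D : set X) (e : K) :
  bounded_approx_unit V -> compact D -> 0 < e ->
  exists N, forall n, (N <= n)%N -> forall x, D x -> `|V n x - x| <= e.
Proof.
move=> [[M M0 VM] Vx] /compact_near_coveringP cD e0.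
have := cD nat \oo (fun n x => `|V n x - x| <= e) _.
case=> [x Dx|N _ NP]; last by exists N => n /NP {}NP x; exact: NP.
have he0 : 0 < h * e by rewrite mulr_gt0 ?invr_gt0.
have M1 : 0 < M + 1 by rewrite ltr_wpDl// ltW.
have [N NP] := Vx x _ he0.
exists (ball x ((M + 1)^-1 * (h * e)), [set n | (N <= n)%N]) => /=.
  split; last by exists N.
  by apply: nbhsx_ballx; rewrite mulr_gt0// invr_gt0.
move=> [y n] /= [xy Nn].
have -> : V n y - y = (V n (y - x) - (y - x)) + (V n x - x).
  by rewrite linearB addrACA -opprD !subrK.
rewrite (le_trans (ler_normD _ _))// -[leRHS]half_double lerD//; last exact: NP.
rewrite (le_trans (ler_normB _ _))//.
rewrite (le_trans (lerD (opnorm_leP _ (VM n)) (lexx _)))//.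
rewrite -{2}[`|y - x|]mul1r -mulrDl -ler_pdivlMl//.
by move: xy; rewrite -ball_normE /= distrC => /ltW.
Qed.

(** The bound e / 2 yields a strict inequality. An empty A is covered: the
    default value 0 is then the supremum. *)
Lemma supremum_lt (A : set K) (e : K) : 0 < e ->
  (forall z, A z -> 0 <= z <= h * e) -> supremum 0 A < e.
Proof.
move=> e0 Ae.
have hee : h * e < e by rewrite gtr_pMl// invf_lt1 // ltr1n.
have [->|/set0P A0] := eqVneq A set0; first by rewrite supremum0.
apply: le_lt_trans hee.
have [//|||_] := @scalar_supremumP R k A.
- by move=> z /Ae/andP[].
- by exists (h * e) => z /Ae/andP[].
- by apply=> z /Ae/andP[].
Qed.

Lemma BCAP_of_compact_approx_unit V :
  bounded_approx_unit V -> (forall n, V n \in compact_op) -> BCAP X.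
Proof.
move=> uV cV; have [[M M0 VM] _] := uV.
exists (M + 1) => [|D cD e e0]; first by rewrite lerDr ltW.
have he0 : 0 < h * e by rewrite mulr_gt0 ?invr_gt0.
have [N NP] := approx_unit_compact uV cD he0.
exists (V N); split=> //; first by rewrite (le_trans (VM N))// lerDl.
by apply: supremum_lt => // _ [x Dx <-]; rewrite normr_ge0 NP.
Qed.

Lemma approx_unit_compact_op V (C : 'L(X)) (e : K) :
  bounded_approx_unit V -> C \in compact_op -> 0 < e ->
  exists n, opnorm (V n * C - C) <= e.
Proof.
move=> uV /compact_opP cC e0.
have [N NP] := approx_unit_compact uV cC e0; exists N.
apply: opnorm_le_ball => x x1.
by apply: (NP N (leqnn N) (C x)); apply: subset_closure; exists x.
Qed.

(** A quantitative form of the fact that a dense subspace containing a closed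
    subspace of finite codimension is the whole space. If V i B = 1 + C with C compact, choose j with
    |V j C - C| <= 1/2; then 1 = V i B - V j C + (V j C - C). Multiplying by D n on
    the left, the first two terms are O(a n), and the third, of norm at most
    |D n| / 2, moves to the other side. *)
Lemma small_of_small_on_approx_unit V (a : nat -> K) (D : nat -> 'L(X)) :
  bounded_approx_unit V ->
  (forall j, exists2 c, 0 <= c & forall n, opnorm (D n * V j) <= c * a n) ->
  (exists j B, V j * B - 1 \in compact_op) ->
  exists2 c, 0 <= c & forall n, opnorm (D n) <= c * a n.
Proof.
move=> uV DV [i [B cB]]; set C := V i * B - 1 in cB.
have CE : V i * B - C = 1 by rewrite /C subKr.
clearbody C.
have [|j jP] := @approx_unit_compact_op V C h uV cB; first by rewrite invr_gt0.
have [ci ci0 iP] := DV i; have [cj cj0 cjP] := DV j.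
exists (2 * (ci * opnorm B + cj * opnorm C)).
  by rewrite mulr_ge0// addr_ge0 ?mulr_ge0 ?opnorm_ge0.
move=> n; set d := opnorm (D n).
have : d <= (ci * opnorm B + cj * opnorm C) * a n + d * h.
  rewrite /d.
  have {1}-> : D n = D n * V i * B - D n * V j * C + D n * (V j * C - C).
    by rewrite mulrBr !mulrA subrKA -mulrA -mulrBr CE mulr1.
  rewrite (le_trans (opnormD _ _))// lerD//.
    rewrite (le_trans (opnormD _ _))// opnormN mulrDl lerD//.
      rewrite (le_trans (opnormM _ _))// mulrAC ler_wpM2r ?opnorm_ge0//.
    by rewrite (le_trans (opnormM _ _))// mulrAC ler_wpM2r ?opnorm_ge0.
  by rewrite (le_trans (opnormM _ _))// ler_wpM2l ?opnorm_ge0.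
rewrite -lerBlDr -mulrA => dP.
by rewrite -ler_pdivrMl// mulrC (le_trans _ dP)// lerBrDr [d * h]mulrC half_double.
Qed.

End ApproximateUnits.

(** * The Calkin algebra *)

Section Calkin.
Context {K : numFieldType} {X : normedModType K}.
Local Open Scope quotient_scope.
Implicit Types S T : 'L(X).

Definition calkin_pi T : 'Cal(X) := \pi_{ideal_quot (@compact_op K X)} T.

Lemma calkin_pi_eq S T : calkin_pi S = calkin_pi T <-> S - T \in compact_op.
Proof.
by rewrite Quotient.idealrBE; split=> [/eqP|/eqP].
Qed.

Lemma calkin_piM S T : calkin_pi (S * T) = calkin_pi S * calkin_pi T.
Proof. exact: pi_calkinM. Qed.

Lemma calkin_pi1 : calkin_pi 1 = 1.
Proof. by rewrite /calkin_pi -[RHS]/(calkin1) piE. Qed.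

Lemma calkin_piX T n : calkin_pi (T ^+ n) = calkin_pi T ^+ n.
Proof.
elim: n => [|n IHn]; first exact: calkin_pi1.
by rewrite !exprS calkin_piM IHn.
Qed.

Lemma calkin_pi0 : calkin_pi 0 = 0.
Proof. by rewrite /calkin_pi piE. Qed.

Lemma calkin_pi_surj (a : 'Cal(X)) : exists T, calkin_pi T = a.
Proof. by exists (repr (a : {ideal_quot (@compact_op K X)})); exact: reprK. Qed.

(** Lifts the alternative between invertible and nilpotent elements from the
    Calkin algebra to operators. *)
Lemma nonunit_power_compact T m :
  (forall a : 'Cal(X), noninvertible a -> a ^+ m = 0) ->
  T ^+ m \in compact_op \/ exists B, T * B - 1 \in compact_op.
Proof.
move=> nil; have [[b [Tb _]]|/nil] := pselect
    (exists b : 'Cal(X), calkin_pi T * b = 1 /\ b * calkin_pi T = 1).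
  right; have [B Bb] := calkin_pi_surj b; exists B.
  by apply/calkin_pi_eq; rewrite calkin_piM Bb Tb calkin_pi1.
by rewrite -calkin_piX -calkin_pi0 => /calkin_pi_eq; rewrite subr0; left.
Qed.

End Calkin.

(** * Strong limits of operators *)

Section StrongLimit.
Context {R : realType} {k : scalar_kind}.
Local Notation K := (scalar_field R k).
Context {X : normedModType K}.

Lemma scale_bop_subproof (a : K) : (fun x : X => a *: x) \in bounded_op.
Proof.
apply/bounded_opP; split=> [b u v|]; last by exists `|a| => x; rewrite normrZ.
by rewrite scalerDr !scalerA mulrC.
Qed.

(** These central elements stand for the scalars inside the ring of operators. *)
Definition scale_bop (a : K) : 'L(X) := Bop (scale_bop_subproof a).

Lemma scale_bop_comm (a : K) (T : 'L(X)) : GRing.comm T (scale_bop a).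
Proof. by apply: bopP => x; exact: linearZ. Qed.

Lemma scale_bopX (a : K) n x : (scale_bop a ^+ n) x = a ^+ n *: x.
Proof.
elim: n x => [|n IHn] x; first by rewrite !expr0 scale1r.
by rewrite exprS [LHS]/= IHn scalerA -exprS.
Qed.

Lemma bop_sumE (I : Type) (r : seq I) (F : I -> 'L(X)) x :
  (\sum_(i <- r) F i) x = \sum_(i <- r) F i x.
Proof. by apply: (big_morph (fun T : 'L(X) => T x)). Qed.

Lemma strong_limit_bop (V : nat -> 'L(X)) (M : K) :
  0 <= M -> (forall n, opnorm (V n) <= M) ->
  (forall x, exists l, seq_tends (fun n => V n x) l) ->
  exists2 S : 'L(X), opnorm S <= M & forall x, seq_tends (fun n => V n x) (S x).
Proof.
move=> M0 VM /choice[S VS].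
have SM x : `|S x| <= M * `|x|.
  by apply: (seq_tends_norm_le (VS x) (N := 0)) => n _; exact: opnorm_leP.
have linS : linear S.
  move=> a u v; apply: seq_tends_unique (VS _) _.
  have -> : (fun n => V n (a *: u + v)) = (fun n => scale_bop a (V n u) + V n v).
    by apply/funext => n; rewrite linearP.
  by apply: seq_tendsD => //; exact: (seq_tends_bop (scale_bop a)).
have bS : S \in bounded_op by apply/bounded_opP; split=> //; exists M.
by exists (Bop bS) => //; exact: opnorm_le.
Qed.

End StrongLimit.

(** * Means of a semigroup *)

Section Semigroup.
Context {R : realType} {k : scalar_kind}.
Local Notation K := (scalar_field R k).
Local Notation h := (2^-1 : K).
Context {X : completeNormedModType K}.
Context (T : R -> 'L(X)) (semiT : C0_semigroup T).

Let T0 : T 0 = 1. Proof. by case: semiT. Qed.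

Let TD t s : 0 <= t -> 0 <= s -> T (t + s) = T t * T s.
Proof. by case: semiT => _ + _; exact. Qed.

Lemma semigroup_natmul t n : 0 <= t -> T (t *+ n) = T t ^+ n.
Proof.
move=> t0; elim: n => [|n IHn]; first by rewrite mulr0n T0.
by rewrite mulrS TD ?mulrn_wge0// IHn exprS.
Qed.

Lemma semigroup_continuous0 x (e : K) : 0 < e ->
  exists n, forall t, 0 <= t <= 2^-1 ^+ n -> `|T t x - x| <= e.
Proof.
case: semiT => _ _ /(_ x) /cvgrPdist_le + e0 => /(_ e e0).
rewrite /at_right near_withinE => -[d /= d0 dP].
have [n nd] := @exists_half_pow_lt R RealScalars d d0.
exists n => t /andP[]; rewrite le_eqVlt => /predU1P[<- _|t0 tn].
  by rewrite T0 subrr normr0 ltW.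
have := dP t; rewrite /= !sub0r !normrN normr_id; apply => //.
by rewrite gtr0_norm// (le_lt_trans tn).
Qed.

(** If T were unbounded near 0, there would be times t_n -> 0 with |T(t_n)| > 2^n,
    although T(t_n) x -> x for every x, against uniform boundedness. The bound on
    [0, 2^-n] extends to [0, 1] because T(t) = T(2^-n t)^(2^n). *)
Lemma semigroup_bounded : exists2 M : K, 0 < M &
  forall t, 0 <= t <= 1 -> opnorm (T t) <= M.
Proof.
have [n [M0 MP]] : exists n, exists M, forall t : R, 0 <= t <= 2^-1 ^+ n ->
    opnorm (T t) <= M.
  apply: contrapT => nb.
  have /choice[t tP] : forall n, exists t : R, 0 <= t <= 2^-1 ^+ n /\
      2 ^+ n < opnorm (T t).
    move=> n; apply: contrapT => nt; apply: nb; exists n, (2 ^+ n) => t tn.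
    rewrite real_leNgt ?ger0_real ?opnorm_ge0 ?exprn_ge0//.
    by apply/negP => ?; apply: nt; exists t.
  have [x|M tM] := @uniform_boundedness _ _ X (T \o t).
    have [n nP] := semigroup_continuous0 x (@ltr01 K).
    pose c := \sum_(i < n) `|T (t i) x|; exists (c + (1 + `|x|)) => i /=.
    have c0 : 0 <= c by apply: sumr_ge0.
    have [ni|lin] := leqP n i.
      rewrite -[T (t i) x](subrK x) ler_wpDl// (le_trans (ler_normD _ _))//.
      rewrite lerD//; apply: nP.
      have /andP[-> /le_trans] /= := (tP i).1; apply.
      by rewrite ler_wiXn2l ?invr_ge0// invf_le1// ler1n.
    rewrite ler_wpDr// /c (bigD1 (Ordinal lin))//= lerDl.
    exact: sumr_ge0.
  have M0 : 0 < M.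
    by apply: lt_le_trans (tM 0%N); apply: lt_trans (tP 0%N).2; rewrite expr0.
  have [n] : exists n, h ^+ n < M^-1 by apply: exists_half_pow_lt; rewrite invr_gt0.
  rewrite exprVn ltf_pV2 ?posrE ?exprn_gt0// => /lt_le_trans/(_ (ltW (tP n).2)).
  by move=> /lt_le_trans/(_ (tM n)); rewrite ltxx.
have M1 : 0 < M0 + 1.
  rewrite ltr_wpDl// (le_trans (opnorm_ge0 (T 0)))// MP//.
  by rewrite lexx exprn_ge0 ?invr_ge0.
exists ((M0 + 1) ^+ (2 ^ n)); first exact: exprn_gt0.
move=> t /andP[t0 t1].
have -> : t = (2^-1 ^+ n * t) *+ (2 ^ n).
  by rewrite -mulr_natl natrX exprVn mulVKf// expf_neq0.
rewrite semigroup_natmul ?mulr_ge0 ?exprn_ge0 ?invr_ge0//.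
rewrite (le_trans (opnormX _ _))// lerXn2r ?nnegrE ?opnorm_ge0 ?(ltW M1)//.
rewrite (le_trans (MP _ _)) ?lerDl// mulr_ge0 ?exprn_ge0 ?invr_ge0//=.
by rewrite ler_piMr// exprn_ge0 ?invr_ge0.
Qed.

Let tau n := T (2^-1 ^+ n).

Lemma dyadic_powE n j : tau n ^+ j = T (2^-1 ^+ n *+ j).
Proof. by rewrite semigroup_natmul// exprn_ge0 ?invr_ge0. Qed.

Lemma dyadic_le n N j : (j <= 2 ^ N)%N ->
  2^-1 ^+ (n + N) *+ j <= 2^-1 ^+ n :> R.
Proof.
move=> jN; rewrite exprD -mulrnAr ler_piMr ?exprn_ge0 ?invr_ge0//.
by rewrite -mulr_natl exprVn ler_pdivrMr ?exprn_gt0// mul1r -natrX ler_nat.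
Qed.

Lemma dyadic_pow2 n N : tau (n + N) ^+ (2 ^ N) = tau n.
Proof.
rewrite dyadic_powE; congr T.
by rewrite exprD -mulr_natr natrX -mulrA -exprMn mulVf// expr1n mulr1.
Qed.

(** The Riemann sum, over 2^N equal pieces, of the mean of T on [0, 2^-n]. *)
Definition riemann_mean N n : 'L(X) :=
  scale_bop h ^+ N * \sum_(j < 2 ^ N) tau (n + N) ^+ j.

Lemma half_comm (S : 'L(X)) N : GRing.comm S (scale_bop h ^+ N).
Proof. exact/commrX/scale_bop_comm. Qed.

Lemma riemann_meanE N n x :
  riemann_mean N n x = h ^+ N *: \sum_(j < 2 ^ N) (tau (n + N) ^+ j) x.
Proof. by rewrite /riemann_mean [LHS]/= scale_bopX bop_sumE. Qed.

Lemma mean_norm_le N (u : 'I_(2 ^ N) -> X) (c : K) :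
  (forall j, `|u j| <= c) -> `|h ^+ N *: \sum_j u j| <= c.
Proof.
move=> uc; rewrite normrZ ger0_norm ?exprn_ge0 ?invr_ge0//.
rewrite exprVn ler_pdivrMl ?exprn_gt0//.
rewrite (le_trans (ler_norm_sum _ _ _))// (le_trans (ler_sum _ (fun j _ => uc j)))//.
by rewrite sumr_const card_ord -[c *+ _]mulr_natl natrX.
Qed.

Lemma riemann_mean_sub_le N n x (e : K) :
  (forall t, 0 <= t <= 2^-1 ^+ n -> `|T t x - x| <= e) ->
  `|riemann_mean N n x - x| <= e.
Proof.
move=> Tx; rewrite riemann_meanE.
have xE : h ^+ N *: \sum_(j < 2 ^ N) x = x.
  rewrite sumr_const card_ord -[x *+ _]scaler_nat scalerA natrX exprVn.
  by rewrite mulVf ?scale1r// expf_neq0.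
rewrite -{2}xE -scalerBr -sumrB; apply: mean_norm_le => j.
rewrite dyadic_powE; apply: Tx.
by rewrite mulrn_wge0 ?exprn_ge0 ?invr_ge0//= dyadic_le// ltnW.
Qed.

Lemma riemann_mean_le N n (M : K) : 0 <= M ->
  (forall t, 0 <= t <= 1 -> opnorm (T t) <= M) -> opnorm (riemann_mean N n) <= M.
Proof.
move=> M0 TM; apply: opnorm_le => // x; rewrite riemann_meanE.
apply: mean_norm_le => j; rewrite dyadic_powE; apply/opnorm_leP/TM.
rewrite mulrn_wge0 ?exprn_ge0 ?invr_ge0//=.
rewrite (le_trans (dyadic_le n (ltnW (ltn_ord j))))//.
by rewrite exprn_ile1 ?invr_ge0// invf_le1 ?ler1n.
Qed.

(** Halving the interval: the second half of the sum is the first half shifted by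
    the time 2^-(n+1). *)
Lemma riemann_meanS N n :
  riemann_mean N.+1 n = scale_bop h * (1 + tau n.+1) * riemann_mean N n.+1.
Proof.
rewrite /riemann_mean addnS -addSn -(mulrA (scale_bop h)) (mulrA (1 + _)).
rewrite half_comm -mulrA mulrA -exprS; congr (_ * _).
rewrite mulrDl mul1r expnS mul2n -addnn big_split_ord /=; congr (_ + _).
rewrite big_distrr /=; apply: eq_bigr => j _.
by rewrite exprD dyadic_pow2.
Qed.

(** Refining a subdivision replaces the value at each node by a mean over the
    following piece. This makes the Riemann sums Cauchy: the factor on the right
    is strongly close to the identity when N is large. *)
Lemma riemann_meanD N p n :
  riemann_mean (N + p) n = riemann_mean N n * riemann_mean p (n + N).
Proof.
elim: N n => [|N IHN] n.
  rewrite addn0 [riemann_mean 0 n]/riemann_mean.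
  by rewrite expr0 expn0 big_ord1 expr0 !mul1r.
by rewrite addSn !riemann_meanS IHN addSnnS !mulrA.
Qed.

(** The discrete form of A int_0^t T(s) ds = T(t) - 1, for A the generator. *)
Lemma riemann_mean_telescope N n :
  (tau (n + N) - 1) * riemann_mean N n = scale_bop h ^+ N * (tau n - 1).
Proof.
by rewrite /riemann_mean mulrA half_comm -mulrA -subrX1 dyadic_pow2.
Qed.


(** S j is the strong limit of the Riemann means on [0, 2^-j]. For n = j + q the
    bound on (tau n - 1) (S j) comes from telescoping the coarse sum with 2^q
    pieces, which gives the factor 2^-q = 2^j 2^-n; for n < j it is trivial, as
    2^j 2^-n >= 1. *)
Lemma mean_operators : exists S : nat -> 'L(X), bounded_approx_unit S /\
  forall j, exists2 c : K, 0 <= c &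
    forall n, opnorm ((tau n - 1) * S j) <= c * h ^+ n.
Proof.
have [M M0 TM] := semigroup_bounded.
have M1 : 0 <= M + 1 by rewrite addr_ge0 ?ltW.
have AM N n : opnorm (riemann_mean N n) <= M.
  exact: riemann_mean_le (ltW M0) TM.
have /choice[S SP] : forall j, exists S : 'L(X), opnorm S <= M /\
    forall x, seq_tends (fun N => riemann_mean N j x) (S x).
  move=> j; have [|S SM AS] := @strong_limit_bop _ _ X _ M (ltW M0) (AM^~ j).
    move=> x; apply: cauchy_seq_tends => e e0.
    have [|N NP] := @semigroup_continuous0 x (M^-1 * e).
      by rewrite mulr_gt0// invr_gt0.
    exists N => p; rewrite riemann_meanD.
    rewrite -[_ - _](linearB (riemann_mean N j)).
    rewrite (le_trans (opnorm_leP _ (AM _ _)))// -ler_pdivlMl//.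
    apply: riemann_mean_sub_le => t /andP[t0 tN]; apply: NP; rewrite t0 /=.
    rewrite (le_trans tN)// ler_wiXn2l ?invr_ge0 ?leq_addl//.
    by rewrite invf_le1 ?ler1n.
  by exists S.
exists S; split.
  split; first by exists M => // j; exact: (SP j).1.
  move=> x e e0; have [N NP] := semigroup_continuous0 x e0.
  exists N => j Nj; apply: (@seq_tends_norm_le _ _ X
      (fun p => riemann_mean p j x - x) _ _ 0%N).
    apply: seq_tendsD; first exact: (SP j).2.
    by move=> e' e'0; exists 0%N => p _; rewrite subrr normr0 ltW.
  move=> p _; apply: riemann_mean_sub_le => t /andP[t0 tj].
  apply: NP; rewrite t0 (le_trans tj)// ler_wiXn2l ?invr_ge0//.
  by rewrite invf_le1 ?ler1n.
have tau1M n : opnorm (tau n - 1) <= M + 1.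
  rewrite (le_trans (opnormD _ _))// opnormN lerD ?opnorm1_le// TM//.
  by rewrite exprn_ge0 ?exprn_ile1 ?invr_ge0// invf_le1 ?ler1n.
move=> j; exists ((M + 1) * M * 2 ^+ j).
  by rewrite !mulr_ge0 ?exprn_ge0// ltW.
move=> n; have [nj|jn] := ltnP n j.
  rewrite (le_trans (opnormM _ _))//.
  rewrite (le_trans (ler_pM _ _ (tau1M n) (SP j).1)) ?opnorm_ge0//.
  rewrite -[leRHS]mulrA ler_peMr ?mulr_ge0 ?(ltW M0)//.
  by rewrite exprVn ler_pdivlMr ?exprn_gt0// mul1r ler_weXn2l ?ler1n// ltnW.
have c0 : 0 <= (M + 1) * M * 2 ^+ j * h ^+ n.
  by rewrite !mulr_ge0 ?exprn_ge0 ?invr_ge0// ltW.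
apply: opnorm_le => // x; have [q nE] : exists q, n = (j + q)%N.
  by exists (n - j)%N; rewrite subnKC.
apply: (@seq_tends_norm_le _ _ X
  (fun p => (tau n - 1) (riemann_mean (q + p) j x)) _ _ 0%N).
  apply/seq_tends_bop/(@seq_tends_shift _ _ _ (fun N => riemann_mean N j x)).
  exact: (SP j).2.
move=> p _; rewrite riemann_meanD.
rewrite -[(tau n - 1) _]/(((tau n - 1) * (riemann_mean q j * _)) x).
rewrite mulrA {1}nE riemann_mean_telescope.
rewrite -mulrA [LHS in `|LHS|]/= scale_bopX normrZ ger0_norm ?exprn_ge0 ?invr_ge0//.
have -> : (M + 1) * M * 2 ^+ j * h ^+ n = h ^+ q * ((M + 1) * M).
  rewrite nE exprD mulrA -(mulrA _ (2 ^+ j)) -exprMn mulfV ?pnatr_eq0//.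
  by rewrite expr1n mulr1 mulrC.
rewrite -mulrA ler_wpM2l ?exprn_ge0 ?invr_ge0//.
rewrite (le_trans (opnorm_leP _ (tau1M _)))// -mulrA ler_wpM2l//.
exact: (opnorm_leP x (AM p (j + q)%N)).
Qed.

(** At the dyadic time j 2^-N, telescoping costs j times the bound at 2^-N, which
    is Lipschitz in time. A general time t is a dyadic one plus a remainder r of
    size at most 2^-N, and T(r) x - x is negligible for N large by strong
    continuity. *)
Lemma uniformly_continuous_of_dyadic (c : K) :
  (forall n, opnorm (tau n - 1) <= c * h ^+ n) ->
  uniformly_continuous_semigroup T.
Proof.
move=> tauc; have [M M0 TM] := semigroup_bounded.
have c0 : 0 <= c.
  by have := le_trans (opnorm_ge0 _) (tauc 0%N); rewrite expr0 mulr1.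
have dyadic N j x : (j <= 2 ^ N)%N ->
    `|T (2^-1 ^+ N *+ j) x - x| <= M * c * h ^+ N * `|x| *+ j.
  elim: j => [_|j IHj jN]; first by rewrite !mulr0n T0 subrr normr0.
  rewrite [in leRHS]mulrS mulrSr TD ?mulrn_wge0 ?exprn_ge0 ?invr_ge0//.
  have -> : (T (2^-1 ^+ N *+ j) * T (2^-1 ^+ N)) x - x =
      T (2^-1 ^+ N *+ j) ((tau N - 1) x) + (T (2^-1 ^+ N *+ j) x - x).
    by rewrite [(tau N - 1) x]/= linearB addrA subrK.
  rewrite (le_trans (ler_normD _ _))// lerD//; last exact/IHj/ltnW.
  rewrite -!mulrA (le_trans (opnorm_leP (c := M) _ _))//.
    apply: TM; rewrite mulrn_wge0 ?exprn_ge0 ?invr_ge0//=.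
    by rewrite -[leRHS](expr0 2^-1) -[N]add0n dyadic_le// ltnW.
  rewrite ler_pM2l// mulrA; exact: (opnorm_leP x (tauc N)).
have Tn n t : 0 <= t <= 2^-1 ^+ n -> opnorm (T t - 1) <= M * c * h ^+ n.
  move=> /andP[t0 tn]; apply: opnorm_le => [|x].
    by rewrite !mulr_ge0 ?exprn_ge0 ?invr_ge0// ltW.
  apply/ler_addgt0Pr => e e0.
  have [|N' NP] := @semigroup_continuous0 x (M^-1 * e).
    by rewrite mulr_gt0 ?invr_gt0.
  pose N := (n + N')%N.
  have u0 : 0 < (2^-1 : R) ^+ N by rewrite exprn_gt0 ?invr_gt0.
  have tu : 0 <= t / 2^-1 ^+ N by rewrite divr_ge0 ?(ltW u0).
  have /andP[] := truncn_itv tu; set j := Num.trunc _.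
  rewrite ler_pdivlMr// ltr_pdivrMr// mulr_natl => jt tj.
  have jN : (j <= 2 ^ N')%N.
    rewrite -(ler_nat R) -(ler_pM2l u0) mulrC mulr_natl (le_trans jt)//.
    rewrite (le_trans tn)// natrX /N exprD -mulrA -exprMn mulVf//.
    by rewrite expr1n mulr1.
  pose r := t - 2^-1 ^+ N *+ j.
  have r0 : 0 <= r by rewrite subr_ge0.
  have ru : r <= 2^-1 ^+ N.
    by rewrite lerBlDr ltW// (lt_le_trans tj)// mulrSr mulrDl mul1r addrC mulr_natl.
  have -> : (T t - 1) x = (T (2^-1 ^+ N *+ j) x - x) +
      T (2^-1 ^+ N *+ j) (T r x - x).
    rewrite -[t in LHS](subrK (2^-1 ^+ N *+ j)) -/r [r + _]addrC.
    rewrite TD ?mulrn_wge0 ?(ltW u0)//.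
    by rewrite linearB [RHS]addrC addrA subrK.
  rewrite (le_trans (ler_normD _ _))// lerD//.
    rewrite (le_trans (dyadic _ _ _ _))//.
      by rewrite (leq_trans jN)// leq_pexp2l// leq_addl.
    rewrite -mulrnAl ler_wpM2r// -mulrnAr ler_wpM2l ?mulr_ge0 ?(ltW M0)//.
    rewrite /N exprD -mulrnAr ler_piMr ?exprn_ge0 ?invr_ge0//.
    rewrite -[_ *+ j]mulr_natl exprVn ler_pdivrMr ?exprn_gt0// mul1r.
    by rewrite -natrX ler_nat.
  rewrite (le_trans (opnorm_leP (c := M) _ _))//.
    apply: TM; rewrite mulrn_wge0 ?(ltW u0)//= (le_trans jt)// (le_trans tn)//.
    by rewrite exprn_ile1 ?invr_ge0// invf_le1 ?ler1n.
  rewrite -ler_pdivlMl//; apply: NP; rewrite r0 (le_trans ru)//.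
  by rewrite ler_wiXn2l ?invr_ge0 ?leq_addl// invf_le1 ?ler1n.
apply/cvgrPdist_le => e e0.
have Mc0 : 0 < M * c + 1 by rewrite ltr_wpDl// mulr_ge0// ltW.
have [n nP] : exists n, h ^+ n < (M * c + 1)^-1 * e.
  by apply: exists_half_pow_lt; rewrite mulr_gt0 ?invr_gt0.
near=> t.
rewrite sub0r normrN ger0_norm ?opnorm_ge0// (le_trans (Tn n t _))//.
  apply/andP; split; near: t; first exact: nbhs_right_ge.
  by apply: nbhs_right_le; rewrite exprn_gt0 ?invr_gt0.
move: nP; rewrite ltr_pdivlMl// => /ltW; apply: le_trans.
by rewrite ler_wpM2r ?exprn_ge0 ?invr_ge0// lerDl.
Unshelve. all: by end_near.
Qed.

End Semigroup.

Theorem theorem1p2 (R : realType) (k : scalar_kind)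
    (X : completeNormedModType (scalar_field R k)) (m : nat) :
  ~ BCAP X ->
  (0 < m)%N ->
  (forall a : 'Cal(X), noninvertible a -> a ^+ m = 0) ->
  Lotz R X.
Proof.
move=> nX _ nil T semiT.
have [S [uS TS]] := mean_operators semiT.
have [j [B cB]] : exists j B, S j * B - 1 \in compact_op.
  apply: contrapT => nB; apply: nX.
  apply: BCAP_of_compact_approx_unit (bounded_approx_unitX m uS) _ => j.
  have [//|[B cB]] := nonunit_power_compact (S j) nil.
  by exfalso; apply: nB; exists j, B.
have [|c _ cP] := small_of_small_on_approx_unit uS TS; first by exists j, B.
exact: (uniformly_continuous_of_dyadic semiT) cP.
Qed.
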